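(* Let $x_1,\ldots,x_n$ be independent random variables with common mean $\mu_x$ and $|x_i-\mu_x|\le C_x$ for a constant $C_x$. Let $s_n=\sum_{i=1}^n x_i$ and let $\hat s_n$ be computed by recursive summation: $\hat s_1=x_1$, $\hat s_k=(\hat s_{k-1}+x_k)(1+\delta_k)$ for $2\le k\le n$, with $E_n=\hat s_n-s_n$. Assume that $\delta_2,\ldots,\delta_n$ are independent random variables of mean zero with $|\delta_k|\le u$, where $0<u<1$, and that $(\delta_2,\ldots,\delta_n)$ is independent of $(x_1,\ldots,x_n)$. Then for any $\delta\in(0,1)$, with probability at least $1-\delta$, \[ |E_n|\le \bigl(1+\tilde\gamma_n(\delta/3)\bigr)\bigl(\lambda|\mu_x|n^{3/2}+\lambda^2C_x n\bigr)u, \] where $\lambda=\lambda(\delta/3)=\sqrt{2\log(6/\delta)}$.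
   Context: For $\delta\in(0,1)$, $\lambda(\delta)=\sqrt{2\log(2/\delta)}$ and $\tilde\gamma_n(\delta)=\exp\!\left(\frac{\lambda(\delta)\sqrt{n}\,u+nu^2}{1-u}\right)-1$. The recurrence models recursive summation in floating-point arithmetic with unit roundoff $u$; $\delta_k$ is the relative rounding error at step $k$. *)

(* Defs.v *)
From HB Require Import structures.
From mathcomp Require Import all_boot all_order all_algebra.
From mathcomp Require Import all_classical all_reals all_analysis.
Set Implicit Arguments. Unset Strict Implicit. Unset Printing Implicit Defensive.
Import Order.TTheory GRing.Theory Num.Theory.
Local Open Scope classical_set_scope.
Local Open Scope ring_scope.

Section Defs.
Context {R : realType} {d : measure_display} {T : measurableType d}.

(* Mutual independence of the random variables X i, i in the finite index
   list J (uniq), in the sense of the product rule on preimages of Borel sets.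
   Subfamilies are covered by taking A i = setT. *)
Definition mutually_independent (P : probability T R) (J : seq nat)
  (X : nat -> T -> R) : Prop :=
  forall A : nat -> set R, (forall i, measurable (A i)) ->
    P (\bigcap_(i in [set` J]) (X i @^-1` A i)) =
    (\prod_(i <- J) P (X i @^-1` A i))%E.

(* Independence of the random vector (X i)_{i in J1} from the random vector
   (Y k)_{k in J2}: the joint law on measurable rectangles (a generating
   pi-system of the product Borel sigma-algebra) is the product. *)
Definition vectors_independent (P : probability T R) (J1 : seq nat)
  (X : nat -> T -> R) (J2 : seq nat) (Y : nat -> T -> R) : Prop :=
  forall A B : nat -> set R, (forall i, measurable (A i)) ->
    (forall k, measurable (B k)) ->
    P ((\bigcap_(i in [set` J1]) (X i @^-1` A i)) `&`
       (\bigcap_(k in [set` J2]) (Y k @^-1` B k))) =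
    (P (\bigcap_(i in [set` J1]) (X i @^-1` A i)) *
     P (\bigcap_(k in [set` J2]) (Y k @^-1` B k)))%E.
End Defs.

Definition exact_sum {R : realType} {T : Type} (x : nat -> T -> R) (k : nat)
  (t : T) : R := \sum_(1 <= i < k.+1) x i t.

Fixpoint rec_sum {R : realType} {T : Type} (x dl : nat -> T -> R) (k : nat)
  (t : T) : R :=
  match k with
  | 0 => 0
  | 1 => x 1%N t
  | (k'.+1) as k1 => (rec_sum x dl k' t + x k1 t) * (1 + dl k1 t)
  end.

Definition lam {R : realType} (dlt : R) : R := Num.sqrt (2 * ln (2 / dlt)).

Definition gamma_tilde {R : realType} (n : nat) (u dlt : R) : R :=
  expR ((lam dlt * Num.sqrt n%:R * u + n%:R * u ^+ 2) / (1 - u)) - 1.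

(* Main.v *)
Require Import Defs.
From HB Require Import structures.
From mathcomp Require Import all_boot all_order all_algebra.
From mathcomp Require Import all_classical all_reals all_analysis.
From mathcomp Require Import measurable_realfun.
From mathcomp Require Import zify ring lra.
Import Order.TTheory GRing.Theory Num.Theory.
Import numFieldNormedType.Exports.
Local Open Scope classical_set_scope.
Local Open Scope ring_scope.
Set Implicit Arguments. Unset Strict Implicit. Unset Printing Implicit Defensive.

(* The error satisfies E_n = sum_k s_k dl_k prod_(j > k) (1 + dl_j).  Order the
   2n - 1 independent variables as x_1, ..., x_n, dl_n, ..., dl_2: then the
   coefficient s_k prod_(j > k) (1 + dl_j) of dl_k depends only on variables that
   precede dl_k, so that E_n is a martingale, and its increments are bounded as
   soon as all partial sums s_k and all products are.  Three applications of the
   maximal Azuma-Hoeffding inequality conclude: to x_i - mu (failure probability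
   dlt / 3), which gives |s_k| <= S = n |mu| + lambda sqrt(n) Cx for all k; to
   the dl_k (one-sided, dlt / 6), which bounds every product by
   exp (lambda sqrt(n) u) <= 1 + gamma_tilde; and to E_n with its coefficients
   truncated at S exp (lambda sqrt(n) u) (dlt / 3). *)

(** * Hoeffding's lemma *)

(** By evenness, take [x >= 0]. There [2 cosh x * exp (- x^2 / 2)], equal to 2 at 0, is
    nonincreasing because [x cosh x - sinh x >= 0]; this last function vanishes at 0 and has
    derivative [x sinh x]. *)
Lemma expRD_expRN_le (R : realType) (x : R) :
  expR x + expR (- x) <= 2 * expR (x ^+ 2 / 2).
Proof.
wlog x0 : x / 0 <= x.
  move=> H; have [|/ltW] := leP 0 x; first exact: H.
  by rewrite -oppr_ge0 => /H; rewrite opprK sqrrN addrC.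
have derive_nonneg (f df : R -> R) :
    (forall t : R, is_derive t (1 : R) f (df t)) -> (forall t : R, 0 <= t -> 0 <= df t) ->
    forall t : R, 0 <= t -> f 0 <= f t.
  move=> fdf df0 t t0; rewrite -subr_ge0.
  have [|c] := MVT_segment t0 (fun s _ => fdf s).
    apply: derivable_within_continuous => s _.
    by have [] := fdf s.
  by rewrite in_itv/= subr0 => /andP[c0 _] ->; rewrite mulr_ge0// df0.
have dexpN (t : R) : is_derive t (1 : R) (fun s : R => expR (- s)) (- expR (- t)).
  have := is_derive1_comp (is_derive_expR (- t)) (is_deriveNid t (1 : R)).
  by rewrite mulrN1.
have k_ge0 (t : R) : 0 <= t -> 0 <= t * (expR t + expR (- t)) - (expR t - expR (- t)).
  pose k (s : R) := s * (expR s + expR (- s)) - (expR s - expR (- s)).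
  move=> t0; have := derive_nonneg k (fun s => s * (expR s - expR (- s))) _ _ t t0.
  rewrite /k/= oppr0 mul0r subrr subr0; apply.
    move=> s.
    apply: is_derive_eq.
    rewrite /= /GRing.scale/=; ring.
  move=> s s0; rewrite mulr_ge0// subr_ge0 ler_expR; lra.
have dsq (t : R) : is_derive t (1 : R) (fun s : R => expR (- (s ^+ 2 / 2)))
    (- t * expR (- (t ^+ 2 / 2))).
  have dq : is_derive t (1 : R) (fun s : R => - (s ^+ 2 / 2)) (- t).
    apply: is_derive_eq; rewrite /= /GRing.scale/=; by field.
  by rewrite mulrC; exact: is_derive1_comp (is_derive_expR _) dq.
pose phi (s : R) := - ((expR s + expR (- s)) * expR (- (s ^+ 2 / 2))).
have := derive_nonneg phi (fun t =>
  (t * (expR t + expR (- t)) - (expR t - expR (- t))) * expR (- (t ^+ 2 / 2))) _ _ x x0.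
rewrite /phi oppr0 expR0 expr0n/= mul0r oppr0 expR0 mulr1 lerN2 (expRN (x ^+ 2 / 2)).
rewrite ler_pdivrMr ?expR_gt0//; apply.
  move=> s; apply: is_derive_eq; rewrite /= /GRing.scale/=; ring.
by move=> s s0; rewrite mulr_ge0 ?k_ge0 ?expR_ge0.
Qed.

(** Convexity: the right side is the chord over [[-c, c]], affine in [y], so that a centered [y]
    will leave only [cosh (a c)] in the mean. When [c = 0], both sides are 1. *)
Lemma expR_le_chord (R : realType) (a c y : R) : `|y| <= c ->
  expR (a * y) <= (expR (a * c) + expR (- (a * c))) / 2
    + (expR (a * c) - expR (- (a * c))) / (2 * c) * y.
Proof.
have [->|c0] := eqVneq c 0.
  rewrite normr_le0 => /eqP ->.
  rewrite !mulr0 oppr0 expR0; lra.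
move=> yc; have {}c0 : 0 < c.
  by rewrite lt_def c0 (le_trans (normr_ge0 y)).
move: yc; rewrite ler_norml => /andP[cy yc].
(* Average, with weights [s] and [1 - s], the tangent at [a * y] evaluated at
   the two endpoints [a * c] and [- (a * c)]. *)
pose s := (y + c) / (2 * c).
have s0 : 0 <= s by rewrite divr_ge0; lra.
have s1 : s <= 1 by rewrite ler_pdivrMr; lra.
have tangent (b : R) : expR (a * y) * (1 + (b - a * y)) <= expR b.
  have -> : expR b = expR (a * y) * expR (b - a * y).
    by rewrite -expRD addrC subrK.
  by rewrite ler_wpM2l ?expR_ge0// expR_ge1Dx.
have h1 := ler_wpM2l s0 (tangent (a * c)).
have s1' : 0 <= 1 - s by lra.
have h2 := ler_wpM2l s1' (tangent (- (a * c))).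
have -> : (expR (a * c) + expR (- (a * c))) / 2
    + (expR (a * c) - expR (- (a * c))) / (2 * c) * y
    = s * expR (a * c) + (1 - s) * expR (- (a * c)).
  by rewrite /s; field; rewrite ?gt_eqF.
apply: (le_trans _ (lerD h1 h2)).
have -> : s * (expR (a * y) * (1 + (a * c - a * y))) +
  (1 - s) * (expR (a * y) * (1 + (- (a * c) - a * y))) = expR (a * y); last by [].
by rewrite /s; field; rewrite ?gt_eqF.
Qed.

Section comparison_sets.
Context d (T : measurableType d) (R : realType) (f g : T -> R).
Hypotheses (mf : measurable_fun setT f) (mg : measurable_fun setT g).

Lemma measurable_set_le : measurable [set t | f t <= g t].
Proof. by rewrite -[X in measurable X]setTI; exact: measurable_fun_le. Qed.

Lemma measurable_set_lt : measurable [set t | f t < g t].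
Proof.
rewrite (_ : [set t | _] = ~` [set t | g t <= f t]).
  by apply: measurableC; rewrite -[X in measurable X]setTI; exact: measurable_fun_le.
by apply/seteqP; split => t /=; rewrite ltNge => /negP.
Qed.

End comparison_sets.

Section hoeffding_lemma.
Context d (T : measurableType d) (R : realType) (P : probability T R).

(** The whole space has measure 1, so it is not an exceptional set. This yields the sign of
    constants that bound a variable only almost everywhere. *)
Lemma ae_exists (Q : T -> Prop) : {ae P, forall t, Q t} -> exists t, Q t.
Proof.
move=> [N [mN PN QN]]; apply: contrapT => /forallNP nQ.
have NT : N = setT by apply/seteqP; split => // t _; exact/QN/nQ.
by move: PN; rewrite NT probability_setT => /eqP; rewrite onee_eq0.
Qed.

Lemma ae_bounded_integrable (Y : T -> R) (c : R) : measurable_fun setT Y ->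
  {ae P, forall t, `|Y t| <= c} -> P.-integrable setT (EFin \o Y).
Proof.
move=> mY Yc; apply/integrableP; split; first exact/measurable_EFinP.
apply: (@le_lt_trans _ _ (\int[P]_t `|c|%:E)%E).
  apply: ae_ge0_le_integral => //.
  - by apply/measurableT_comp => //; exact/measurable_EFinP.
  - by apply: filterS Yc => t Yt _; rewrite /= lee_fin (le_trans Yt)// ler_norm.
by rewrite integral_cst//= probability_setT mule1 ltry.
Qed.

(** Integrating the chord bound removes its linear term and leaves [cosh (a c)]. *)
Lemma hoeffding_mgf (Y : T -> R) (c a : R) : measurable_fun setT Y ->
  {ae P, forall t, `|Y t| <= c} -> (\int[P]_t (Y t)%:E = 0)%E ->
  (\int[P]_t (expR (a * Y t))%:E <= (expR (a ^+ 2 * c ^+ 2 / 2))%:E)%E.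
Proof.
move=> mY Yc Y0.
set A := (expR (a * c) + expR (- (a * c))) / 2.
set B := (expR (a * c) - expR (- (a * c))) / (2 * c).
have mL : measurable_fun setT (fun t => A + B * Y t).
  by apply: measurable_funD => //; exact: measurable_funM.
have mexp : measurable_fun setT (fun t => expR (a * Y t)).
  by apply: measurableT_comp => //; exact: measurable_funM.
have chord : {ae P, forall t, expR (a * Y t) <= A + B * Y t}.
  by apply: filterS Yc => t; exact: expR_le_chord.
(* Where [|Y t| <= c] fails the chord may be negative. The absolute value keeps the comparison
   between nonnegative functions; it is then dropped almost everywhere. *)
apply: (@le_trans _ _ (\int[P]_t `|(A + B * Y t)%:E|)%E).
  apply: ae_ge0_le_integral => //.
  - exact/measurable_EFinP.
  - by apply/measurableT_comp => //; exact/measurable_EFinP.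
  - by apply: filterS chord => t le _; rewrite /= lee_fin (le_trans le)// ler_norm.
have -> : (\int[P]_t `|(A + B * Y t)%:E| = \int[P]_t (A + B * Y t)%:E)%E.
  apply: ae_eq_integral => //.
  - by apply/measurableT_comp => //; exact/measurable_EFinP.
  - exact/measurable_EFinP.
  - apply: filterS chord => t le _; rewrite /= ger0_norm//.
    by rewrite (le_trans _ le)// expR_ge0.
have iY := ae_bounded_integrable mY Yc.
under eq_integral do rewrite EFinD EFinM.
have iBY : P.-integrable setT (fun t => B%:E * (Y t)%:E)%E.
  exact: (integrableZl measurableT B iY).
rewrite integralD//; last exact: finite_measure_integrable_cst.
have -> : (\int[P]_t (B%:E * (Y t)%:E) = 0)%E.
  by rewrite (integralZl measurableT iY)/= Y0 mule0.
rewrite adde0 integral_cst//= probability_setT mule1.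
rewrite lee_fin /A ler_pdivrMr// [leRHS]mulrC -exprMn.
exact: expRD_expRN_le.
Qed.

End hoeffding_lemma.

(** * Independence and Tonelli's theorem *)

Section independence.
Context d (T : measurableType d) (R : realType) (P : probability T R).
Variables (G : set (set T)) (Y : {mfun T >-> R}).
Hypotheses (Gm : G `<=` measurable) (GI : setI_closed G) (GT : G setT).
Hypothesis indep : forall S, G S -> forall A, measurable A ->
  P (S `&` Y @^-1` A) = (P S * P (Y @^-1` A))%E.

Let mpre (A : set R) : measurable A -> measurable (Y @^-1` A).
Proof. by move=> mA; rewrite -[X in measurable X]setTI; exact: measurable_funP. Qed.

(** Both sides are finite measures in [S] that agree on the pi-system [G], which contains the whole
    space; hence they agree on the generated sigma-algebra. *)
Lemma indep_sigma_algebra S : <<s G >> S -> forall A, measurable A ->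
  P (S `&` Y @^-1` A) = (P S * P (Y @^-1` A))%E.
Proof.
move=> GS A mA; have mYA := mpre mA.
set p := P (Y @^-1` A).
have pE : p = (fine p)%:E by rewrite fineK// fin_num_measure.
have p0 : 0 <= fine p by apply: fine_ge0; exact: measure_ge0.
pose m1 := mrestr P mYA.
pose m2 := mscale (NngNum p0) P.
have -> : P (S `&` Y @^-1` A) = m1 S by [].
have m2E B : (P B * p = m2 B)%E by rewrite pE muleC.
rewrite m2E.
apply: (@g_sigma_algebra_measure_unique _ _ _ G Gm (fun=> setT)) => //.
- by rewrite bigcup_const.
- by move=> B GB; transitivity (P B * p)%E; [exact: indep|exact: m2E].
- by move=> _; rewrite /= /m1 /mrestr setTI (le_lt_trans (probability_le1 _ _)) ?ltry.
Qed.

Lemma measurable_tonelli_indep (f : g_sigma_algebraType G * R -> \bar R) :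
  measurable_fun setT f -> (forall z, 0 <= f z)%E ->
  measurable_fun setT (fun t : T => \int[P]_s f (t, Y s))%E.
Proof.
move=> mf f0 _ B mB.
have := measurable_fun_fubini_tonelli_F (m2 := distribution P Y) f mf f0.
move=> /(_ measurableT B mB) mFB.
apply: (smallest_sub (@sigma_algebra_measurable _ T) Gm).
rewrite (_ : (fun t => _) = fubini_F (distribution P Y) f)//.
apply/funext => t; rewrite /fubini_F ge0_integral_distribution//.
by apply: measurableT_comp => //; exact: measurable_fun_pair.
Qed.

(** This stands in for conditioning on [<<G>>]. The identity map into [T] with the smaller
    sigma-algebra is independent of [Y], so their joint law is a product and [Y] can be integrated
    out with the past frozen at [t]. *)
Lemma tonelli_indep (f : g_sigma_algebraType G * R -> \bar R) :
  measurable_fun setT f -> (forall z, 0 <= f z)%E ->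
  (\int[P]_t f (t, Y t) = \int[P]_t \int[P]_s f (t, Y s))%E.
Proof.
move=> mf f0; pose TG := g_sigma_algebraType G.
have subG : <<s G >> `<=` measurable.
  exact: (smallest_sub (@sigma_algebra_measurable _ T)).
have mid : measurable_fun setT (id : T -> TG).
  by move=> _ B mB; rewrite setTI; exact: subG.
have mXY : measurable_fun setT (fun t => (t, Y t) : TG * R).
  exact: measurable_fun_pair.
pose X : {mfun T >-> TG} := mfun_Sub (mem_set mid).
pose XY : {mfun T >-> (TG * R)%type} := mfun_Sub (mem_set mXY).
have step1 : (\int[P]_t f (t, Y t) = \int[distribution P XY]_z f z)%E.
  by rewrite ge0_integral_distribution.
rewrite step1.
have -> : (\int[distribution P XY]_z f z =
    \int[distribution P X \x distribution P Y]_z f z)%E.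
  apply: eq_measure_integral => A mA _.
  apply/esym/product_measure_unique => // B C mB mC.
  exact: indep_sigma_algebra.
rewrite fubini_tonelli1// ge0_integral_distribution//; last 2 first.
- exact: measurable_fun_fubini_tonelli_F.
- by move=> t; apply: integral_ge0.
apply: eq_integral => t _ /=.
rewrite /fubini_F ge0_integral_distribution//.
by apply: measurableT_comp => //; exact: measurable_fun_pair.
Qed.

End independence.

(** * The filtration generated by the preceding variables *)

Section history.
Context d (T : measurableType d) (R : realType).
Variable W : nat -> {mfun T >-> R}.

(** A pi-system generating the past of step [k], kept as rectangles because the product rule is
    given on rectangles. *)
Definition hist (k : nat) : set (set T) :=
  [set S | exists2 A : nat -> set R, (forall i, measurable (A i)) &
    S = \big[setI/setT]_(i < k) (W i @^-1` A i)].

(** Index [k] sees only [W i] with [i < k]: a coefficient of [W k] that is adapted at [k] is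
    predictable. *)
Definition adapted (k : nat) (f : T -> R) : Prop :=
  measurable_fun setT (f : g_sigma_algebraType (hist k) -> R).

Let mpre i (A : set R) : measurable A -> measurable (W i @^-1` A).
Proof. by move=> mA; rewrite -[X in measurable X]setTI; exact: measurable_funP. Qed.

Lemma hist_measurable k : hist k `<=` measurable.
Proof.
by move=> _ [A mA ->]; apply: bigsetI_measurable => i _; exact: mpre.
Qed.

Lemma hist_setI k : setI_closed (hist k).
Proof.
move=> _ _ [A mA ->] [B mB ->]; exists (fun i => A i `&` B i).
  by move=> i; exact: measurableI.
by rewrite -big_split/=; apply: eq_bigr => i _; rewrite preimage_setI.
Qed.

Lemma hist_setT k : hist k setT.
Proof.
exists (fun=> setT) => //.
by rewrite big1// => i _; rewrite preimage_setT.
Qed.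

Lemma hist_preimage i k (A : set R) : (i < k)%N -> measurable A ->
  hist k (W i @^-1` A).
Proof.
move=> ik mA; exists (fun j => if j == i then A else setT).
  by move=> j; case: ifP.
rewrite (bigD1 (Ordinal ik))//= eqxx big1 ?setIT// => j.
by rewrite -val_eqE/= => /negbTE ->; rewrite preimage_setT.
Qed.

Lemma sub_hist k l : (k <= l)%N -> hist k `<=` hist l.
Proof.
move=> kl _ [A mA ->]; exists (fun i => if (i < k)%N then A i else setT).
  by move=> i; case: ifP.
rewrite (big_ord_widen_cond _ xpredT (fun i => W i @^-1` A i) kl) big_mkcond/=.
by apply: eq_bigr => i _; case: ifP => // _; rewrite preimage_setT.
Qed.

Lemma adapted_le k l f : (k <= l)%N -> adapted k f -> adapted l f.
Proof.
move=> kl mf _ B mB; have := mf measurableT B mB.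
exact: (sub_sigma_algebra2 (sub_hist kl)).
Qed.

Lemma adapted_measurable k f : adapted k f -> measurable_fun setT f.
Proof.
move=> mf _ B mB; have := mf measurableT B mB.
exact: (smallest_sub (@sigma_algebra_measurable _ T) (@hist_measurable k)).
Qed.

Lemma adapted_nth i k : (i < k)%N -> adapted k (W i).
Proof.
by move=> ik _ B mB; rewrite setTI; apply: sub_sigma_algebra; exact: hist_preimage.
Qed.

Lemma adapted_sum k m n (f : nat -> T -> R) :
  (forall i, (m <= i < n)%N -> adapted k (f i)) ->
  adapted k (fun t => \sum_(m <= i < n) f i t).
Proof.
move=> mf.
(* Summands outside the range carry no hypothesis; replacing them by 0 makes every summand
   measurable. *)
have -> : (fun t => \sum_(m <= i < n) f i t) =
    (fun t => \sum_(m <= i < n) (if (m <= i < n)%N then f i t else 0)).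
  by apply/funext => t; apply: eq_big_nat => i mi; rewrite mi.
by apply: measurable_sum => i; case: (boolP (m <= i < n)%N) => // mi; exact: mf.
Qed.

Lemma adapted_prod k m n (f : nat -> T -> R) :
  (forall i, (m <= i < n)%N -> adapted k (f i)) ->
  adapted k (fun t => \prod_(m <= i < n) f i t).
Proof.
move=> mf; apply: measurable_prod => i; rewrite mem_index_iota; exact: mf.
Qed.

Variable P : probability T R.

(** Choosing the whole line for the indices from [k] on makes their factors trivial on both
    sides. *)
Lemma mutually_independent_prefix N k : (k <= N)%N ->
  mutually_independent P (iota 0 N) (fun i => W i : T -> R) ->
  forall A : nat -> set R, (forall i, measurable (A i)) ->
  P (\big[setI/setT]_(i < k) (W i @^-1` A i)) =
  (\prod_(i < k) P (W i @^-1` A i))%E.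
Proof.
move=> kN indep A mA; pose B i := if (i < k)%N then A i else setT.
have mB i : measurable (B i) by rewrite /B; case: ifP.
have := indep B mB.
have iE : iota 0 N = index_iota 0 N by rewrite /index_iota subn0.
rewrite bigcap_seq iE !big_mkord.
rewrite (big_ord_widen_cond _ xpredT (fun i => W i @^-1` A i) kN).
rewrite (big_ord_widen_cond _ xpredT (fun i => P (W i @^-1` A i)) kN) => H.
transitivity (P (\big[setI/setT]_(i < N) (W i @^-1` B i))).
  congr (P _); rewrite big_mkcond/=; apply: eq_bigr => i _; rewrite /B.
  by case: ifP => // _; rewrite preimage_setT.
rewrite H [RHS]big_mkcond/=; apply: eq_bigr => i _; rewrite /B.
by case: ifP => // _; rewrite preimage_setT probability_setT.
Qed.

Lemma mutually_independent_iota_le N k : (k <= N)%N ->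
  mutually_independent P (iota 0 N) (fun i => W i : T -> R) ->
  mutually_independent P (iota 0 k) (fun i => W i : T -> R).
Proof.
move=> kN indep A mA; have := mutually_independent_prefix kN indep mA.
have iE : iota 0 k = index_iota 0 k by rewrite /index_iota subn0.
by rewrite bigcap_seq iE !big_mkord.
Qed.

(** The product rule for [k + 1] variables splits off the factor of [W k]; the rule for [k]
    variables recombines the others into [P S]. *)
Lemma hist_indep N k : (k < N)%N ->
  mutually_independent P (iota 0 N) (fun i => W i : T -> R) ->
  forall S, hist k S -> forall A, measurable A ->
  P (S `&` W k @^-1` A) = (P S * P (W k @^-1` A))%E.
Proof.
move=> kN indep _ [B mB ->] A mA.
pose C i := if i == k then A else B i.
have mC i : measurable (C i) by rewrite /C; case: ifP.
have CB (i : 'I_k) : C i = B i by rewrite /C ltn_eqF.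
have := mutually_independent_prefix kN indep mC.
rewrite !big_ord_recr/= {2 4}/C eqxx.
under eq_bigr do rewrite CB.
under [in RHS]eq_bigr do rewrite CB.
by move=> ->; rewrite (mutually_independent_prefix (ltnW kN) indep mB).
Qed.

End history.

(** * The Azuma-Hoeffding inequality *)

Section azuma.
Context d (T : measurableType d) (R : realType) (P : probability T R).
Variables (W : nat -> {mfun T >-> R}) (N m : nat) (e : nat -> R) (c : R).
Hypothesis indep : mutually_independent P (iota 0 N) (fun i => W i : T -> R).
Hypothesis W_mean : forall k, (m <= k < N)%N ->
  (\int[P]_t (W k t - e k)%:E = 0)%E.
Hypothesis W_bounded : forall k, (m <= k < N)%N ->
  {ae P, forall t, `|W k t - e k| <= c}.

(* The centering [e] and the range start [m] allow one sequence [W] to carry both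
   the data, with mean [mu], and the centered rounding errors. *)
Definition mart (a : nat -> T -> R) (n : nat) (t : T) : R :=
  \sum_(m <= k < n) a k t * (W k t - e k).

Lemma adapted_mart a n : (forall k, adapted W k (a k)) -> adapted W n (mart a n).
Proof.
move=> ma; apply: adapted_sum => k /andP[_ kn].
apply: measurable_funM; first exact: adapted_le (ltnW kn) (ma k).
by apply: measurable_funB => //; exact: adapted_nth.
Qed.

(** Induction on [n]: with the past frozen at [t], Hoeffding's lemma at parameter [s * a n t] bounds
    the new factor by [expR (s^2 (b c)^2 / 2)], uniformly in [t]. *)
Lemma azuma_mgf (a : nat -> T -> R) (b : R) n (s : R) : (forall k, adapted W k (a k)) ->
  (forall k t, `|a k t| <= b) -> (m <= n <= N)%N ->
  (\int[P]_t (expR (s * mart a n t))%:E <=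
    (expR (s ^+ 2 * ((n - m)%:R * (b * c) ^+ 2) / 2))%:E)%E.
Proof.
move=> ma ab; elim: n => [|n IH] /andP[mn nN].
  move: mn; rewrite leqn0 => /eqP m0.
  under eq_integral do rewrite /mart big_geq// mulr0 expR0.
  by rewrite m0 subnn mul0r mulr0 mul0r expR0 integral_cst//= probability_setT mul1e.
move: mn; rewrite leq_eqVlt => /predU1P[mn|mn].
  under eq_integral do rewrite /mart -mn big_geq// mulr0 expR0.
  by rewrite mn subnn mul0r mulr0 mul0r expR0 integral_cst//= probability_setT mul1e.
rewrite ltnS in mn.
have mL := adapted_mart (n := n) ma.
(* [z.1] carries the past and [z.2] the fresh value of [W n]. *)
pose F (z : g_sigma_algebraType (hist W n) * R) : \bar R :=
  (expR (s * mart a n z.1) * expR (s * a n z.1 * (z.2 - e n)))%:E.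
have mF : measurable_fun setT F.
  have m1 (f : T -> R) : adapted W n f ->
      measurable_fun setT (fun z : g_sigma_algebraType (hist W n) * R => f z.1).
    by move=> mf; exact: (measurableT_comp mf).
  apply/measurable_EFinP; apply: measurable_funM; apply: measurableT_comp => //.
    by apply: measurable_funM => //; exact: m1.
  apply: measurable_funM; first by apply: measurable_funM => //; exact: m1.
  exact: measurable_funB.
have F0 z : (0 <= F z)%E by rewrite lee_fin mulr_ge0 ?expR_ge0.
have tonelli := tonelli_indep (@hist_measurable _ _ _ W n) (@hist_setI _ _ _ W n)
  (@hist_setT _ _ _ W n) (hist_indep nN indep) mF F0.
have -> : (\int[P]_t (expR (s * mart a n.+1 t))%:E = \int[P]_t F (t, W n t))%E.
  apply: eq_integral => t _; rewrite /F/= -expRD /mart big_nat_recr//=.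
  by rewrite mulrDr mulrA.
rewrite tonelli.
have mexp : measurable_fun setT (fun t => expR (s * mart a n t)).
  apply: measurableT_comp => //; apply: measurable_funM => //.
  exact: adapted_measurable mL.
pose K := expR (s ^+ 2 * (b * c) ^+ 2 / 2).
apply: (@le_trans _ _ (\int[P]_t (K%:E * (expR (s * mart a n t))%:E))%E).
  apply: ge0_le_integral => //.
  - by move=> t _; exact: integral_ge0.
  - exact: (measurable_tonelli_indep P (W n) (@hist_measurable _ _ _ W n) mF F0).
  - apply: measurable_funeM; exact/measurable_EFinP.
  - move=> t _; rewrite /F/=.
    under eq_integral do rewrite EFinM.
    rewrite ge0_integralZl//=; last first.
    + by apply/measurable_EFinP; apply: measurableT_comp => //;
        apply: measurable_funM => //; exact: measurable_funB.
    rewrite muleC; apply: lee_wpmul2r; first by rewrite lee_fin expR_ge0.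
    have mn' : (m <= n < N)%N by rewrite mn.
    apply: le_trans (hoeffding_mgf _ _ (W_bounded mn') (W_mean mn')) _.
      exact: measurable_funB.
    rewrite lee_fin ler_expR ler_pM2r// !exprMn -mulrA ler_wpM2l ?sqr_ge0//.
    rewrite ler_wpM2r ?sqr_ge0// -(real_normK (num_real (a n t))) lerXn2r//.
    by rewrite nnegrE (le_trans _ (ab n t)).
rewrite ge0_integralZl//=; last 2 first.
- exact/measurable_EFinP.
- by rewrite lee_fin expR_ge0.
have mnN : (m <= n <= N)%N by rewrite mn ltnW.
apply: (le_trans (lee_wpmul2l _ (IH mnN))); first by rewrite lee_fin expR_ge0.
rewrite -EFinM -expRD lee_fin ler_expR subSn// -natr1; nra.
Qed.

(** Chernoff's bound at [s = lambda / (sqrt (N - m) b c)], where the exponent is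
    [lambda^2 / 2 - lambda^2]. The strict inequality in the event covers the degenerate cases
    [N = m] and [b c = 0], whose threshold is 0. *)
Lemma azuma_tail (a : nat -> T -> R) (b lambda : R) : 0 < lambda -> (m <= N)%N ->
  (forall k, adapted W k (a k)) -> (forall k t, `|a k t| <= b) ->
  (P [set t | (lambda * Num.sqrt (N - m)%:R * (b * c) < mart a N t)%R] <=
    (expR (- (lambda ^+ 2 / 2)))%:E)%E.
Proof.
move=> l0 mN ma ab.
have mM : measurable_fun setT (mart a N).
  exact: adapted_measurable (adapted_mart (n := N) ma).
have [Nm|mN'] := leqP N m.
  rewrite (_ : [set t | _] = set0) ?measure0 ?lee_fin ?expR_ge0//.
  apply/seteqP; split => // t /=; rewrite /mart big_geq//.
  by move: Nm; rewrite -subn_eq0 => /eqP ->; rewrite sqrtr0 mulr0 mul0r ltxx.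
have [t0 _] : exists t : T, True by exists point.
have b0 : 0 <= b by rewrite (le_trans _ (ab m t0)).
have c0 : 0 <= c.
  have mkN : (m <= m < N)%N by rewrite leqnn.
  by have [t] := ae_exists (W_bounded mkN); apply: le_trans.
(* If [b c = 0], no such [s] exists, but every increment vanishes almost surely and the event is
   null. *)
have := mulr_ge0 b0 c0; rewrite le_eqVlt => /predU1P[bc0|bc0].
  rewrite -bc0 mulr0.
  have : {ae P, forall t, forall k, (m <= k < N)%N -> a k t * (W k t - e k) = 0}.
    apply: ae_foralln => k.
    have [mkN|] := boolP (m <= k < N)%N; last by move=> _; exact: aeW.
    apply: filterS (W_bounded mkN) => t Wc _; apply/eqP.
    rewrite -normr_eq0 normrM -normr_le0 normrM !normr_id bc0.
    by rewrite ler_pM.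
  move=> [B [mB PB0 subB]].
  rewrite (_ : P _ = 0%E) ?lee_fin ?expR_ge0//.
  apply: (subset_measure0 _ mB _ PB0).
    exact: (measurable_set_lt (f := cst _)).
  apply: subset_trans subB => t /= + H.
  rewrite /mart big1_seq ?ltxx// => k /andP[_]; rewrite mem_index_iota; exact: H.
set V := (N - m)%:R * (b * c) ^+ 2.
have n0 : 0 < (N - m)%:R :> R by rewrite ltr0n subn_gt0.
pose q := Num.sqrt (N - m)%:R : R.
have q0 : 0 < q by rewrite sqrtr_gt0.
pose s := lambda / (q * (b * c)).
have s0 : 0 < s by rewrite divr_gt0// mulr_gt0.
have VE : V = (q * (b * c)) ^+ 2 by rewrite exprMn sqr_sqrtr// ltW.
pose X : {RV P >-> R} := mfun_Sub (mem_set mM).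
have := chernoff X (lambda * q * (b * c)) s0.
rewrite /mmt_gen_fun unlock => H.
apply: (@le_trans _ _ (P [set t | lambda * q * (b * c) <= X t])).
  apply: le_measure; rewrite ?inE.
  - exact: (measurable_set_lt (f := cst _)).
  - exact: (measurable_set_le (f := cst _)).
  - by move=> t /= /ltW.
apply: (le_trans H).
have mgf := azuma_mgf s ma ab (n := N).
rewrite mN leqnn in mgf; have {}mgf := mgf isT.
apply: (@le_trans _ _ ((expR (s ^+ 2 * V / 2))%:E *
    (expR (- (s * (lambda * q * (b * c)))))%:E)%E).
  apply: lee_wpmul2r; first by rewrite lee_fin expR_ge0.
  apply: le_trans mgf; rewrite le_eqVlt; apply/orP; left; apply/eqP.
  by apply: eq_integral => t _ /=; rewrite mulrC.
rewrite -EFinM -expRD lee_fin ler_expR VE /s.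
rewrite le_eqVlt; apply/orP; left; apply/eqP; field.
have /andP[bn cn] : (b != 0) && (c != 0) by rewrite -negb_or -mulf_eq0 gt_eqF.
by rewrite bn cn (gt_eqF q0).
Qed.

(* Stopping at the first passage above [r] is again a predictable choice of
   coefficients, so the tail bound at time [N] controls the running maximum. *)
Let stopped (a : nat -> T -> R) (r : R) (k : nat) (t : T) : R :=
  a k t * \prod_(m <= j < k.+1) (mart a j t <= r)%R%:R.

(** Let [l] be the first index where [mart a] exceeds [r]. The indicator products are 1 before [l]
    and 0 from [l] on, so the stopped sum at [N] equals [mart a l t]. *)
Let martN_stopped (a : nat -> T -> R) (r : R) (t : T) k :
  (m <= k <= N)%N -> r < mart a k t -> r < mart (stopped a r) N t.
Proof.
move=> mkN rk.
have ex : exists k, (m <= k <= N)%N && (r < mart a k t) by exists k; rewrite mkN.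
case: (ex_minnP ex) => l /andP[/andP[ml lN] rl] lmin.
have tail0 : \sum_(l <= i < N) stopped a r i t * (W i t - e i) = 0.
  rewrite big1_seq// => i /andP[_]; rewrite mem_index_iota => /andP[li _].
  rewrite /stopped (bigD1_seq l) ?iota_uniq ?mem_index_iota ?ml//=.
  by rewrite leNgt rl mul0r mulr0 mul0r.
rewrite {1}/mart (big_cat_nat ml lN)/= tail0 addr0.
have -> : \sum_(m <= i < l) stopped a r i t * (W i t - e i) = mart a l t; last by [].
apply: eq_big_nat => i /andP[mi il]; rewrite /stopped; congr (_ * _).
rewrite big1_seq ?mulr1// => j /andP[_]; rewrite mem_index_iota => /andP[mj ji].
suff -> : mart a j t <= r by [].
rewrite leNgt; apply/negP => rj.
have jl : (j < l)%N by exact: leq_trans ji il.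
have := lmin j; rewrite mj rj (leq_trans (ltnW jl) lN)/= => /(_ isT).
by rewrite leqNgt jl.
Qed.

Lemma azuma_max (a : nat -> T -> R) (b lambda : R) : 0 < lambda -> (m <= N)%N ->
  (forall k, adapted W k (a k)) -> (forall k t, `|a k t| <= b) ->
  exists B, [/\ measurable B, (P B <= (expR (- (lambda ^+ 2 / 2)))%:E)%E &
    forall t, ~ B t -> forall k, (m <= k <= N)%N ->
      mart a k t <= lambda * Num.sqrt (N - m)%:R * (b * c)].
Proof.
move=> l0 mN ma ab; set r := lambda * _ * _.
(* The indicators at [k] involve [mart a j] for [j <= k], hence only [W i] with [i < k]. *)
have mst k : adapted W k (stopped a r k).
  apply: measurable_funM; first exact: ma.
  apply: adapted_prod => j; rewrite ltnS => /andP[_ jk].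
  have mj : adapted W k (mart a j) := adapted_le jk (adapted_mart ma).
  have -> : (fun t => (mart a j t <= r)%R%:R) =
      (\1_[set t | mart a j t <= r] : g_sigma_algebraType (hist W k) -> R).
    apply/funext => t; rewrite indicE; congr ((nat_of_bool _)%:R).
    by apply/idP/idP; rewrite inE.
  by apply: measurable_indic; exact: (measurable_set_le mj (measurable_cst r)).
have stb k t : `|stopped a r k t| <= b.
  rewrite /stopped normrM normr_prod; apply: le_trans (ab k t).
  rewrite ler_piMr// prodr_ile1// => j _.
  by case: (mart a j t <= r)%R; rewrite /= ?normr1 ?normr0 ?lexx ?ler01.
exists [set t | r < mart (stopped a r) N t]; split.
- apply: (measurable_set_lt (f := cst _)) => //.
  exact: adapted_measurable (adapted_mart (n := N) mst).
- exact: azuma_tail mst stb.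
- move=> t /negP; rewrite -leNgt => rN k mkN; rewrite leNgt; apply/negP => rk.
  by move: rN; rewrite leNgt (martN_stopped mkN rk).
Qed.

Lemma azuma_max_abs (a : nat -> T -> R) (b lambda : R) : 0 < lambda -> (m <= N)%N ->
  (forall k, adapted W k (a k)) -> (forall k t, `|a k t| <= b) ->
  exists B, [/\ measurable B, (P B <= (2 * expR (- (lambda ^+ 2 / 2)))%:E)%E &
    forall t, ~ B t -> forall k, (m <= k <= N)%N ->
      `|mart a k t| <= lambda * Num.sqrt (N - m)%:R * (b * c)].
Proof.
move=> l0 mN ma ab.
have [B [mB PB aB]] := azuma_max l0 mN ma ab.
have [||B' [mB' PB' aB']] := @azuma_max (fun k t => - a k t) b _ l0 mN.
- by move=> k; exact: measurableT_comp (ma k).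
- by move=> k t; rewrite normrN.
exists (B `|` B'); split; first exact: measurableU.
- by rewrite (le_trans (measureU2 P mB mB'))// mulr2n mulrDl mul1r EFinD leeD.
- move=> t /not_orP[nB nB'] k mkN; rewrite ler_norml aB// andbT lerNl.
  apply: le_trans (aB' t nB' k mkN).
  by rewrite /mart -sumrN; apply: ler_sum => i _; rewrite mulNr.
Qed.

End azuma.

(** * The summation error *)

(** The substitution [l = 2 n - i], which undoes the backward ordering of the rounding errors. *)
Lemma big_nat_reflect (S : Type) (idx : S) (op : Monoid.com_law idx) (n j : nat)
    (G : nat -> S) : (n <= j <= n + n)%N ->
  \big[op/idx]_(n <= i < j) G (n + n - i)%N =
  \big[op/idx]_((n + n - j).+1 <= l < n.+1) G l.
Proof.
move=> /andP[nj jn].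
rewrite -{1}[n]add0n big_addn -[(n + n - j).+1 in RHS]add0n big_addn big_nat_rev/=.
rewrite (_ : (n.+1 - (n + n - j).+1 = j - n)%N); last by lia.
by apply: eq_big_nat => i /andP[_ ij]; congr G; lia.
Qed.

(** Unrolls [E_(k+1) = E_k (1 + dl_(k+1)) + s_(k+1) dl_(k+1)] from [E_1 = 0]. *)
Lemma rec_sum_error (R : realType) (T : Type) (x dl : nat -> T -> R) (n : nat) t :
  rec_sum x dl n.+1 t - exact_sum x n.+1 t =
  \sum_(2 <= k < n.+2) exact_sum x k t * dl k t
    * \prod_(k.+1 <= j < n.+2) (1 + dl j t).
Proof.
elim: n => [|n IH].
  by rewrite /exact_sum big_nat1 big_geq// subrr.
have recE : rec_sum x dl n.+2 t =
    (rec_sum x dl n.+1 t + x n.+2 t) * (1 + dl n.+2 t) by [].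
have exactE : exact_sum x n.+2 t = exact_sum x n.+1 t + x n.+2 t.
  by rewrite /exact_sum big_nat_recr.
rewrite recE big_nat_recr// (big_geq (leqnn n.+3)) mulr1.
have -> : \sum_(2 <= k < n.+2) exact_sum x k t * dl k t
    * \prod_(k.+1 <= j < n.+3) (1 + dl j t) =
    (rec_sum x dl n.+1 t - exact_sum x n.+1 t) * (1 + dl n.+2 t).
  rewrite IH big_distrl/=; apply: eq_big_nat => k /andP[_ kn].
  by rewrite big_nat_recr//= mulrA.
rewrite exactE; set r := rec_sum _ _ _ _; rewrite /=; ring.
Qed.

Lemma measurable_rec_sum d (T : measurableType d) (R : realType)
    (x dl : nat -> {mfun T >-> R}) k :
  measurable_fun setT (rec_sum (fun i => x i : T -> R) (fun i => dl i : T -> R) k).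
Proof.
elim: k => [|[|k] IH]; [exact: (measurable_cst (0 : R))|exact: measurable_funP|].
by apply: measurable_funM; exact: measurable_funD.
Qed.

(** Termwise [1 + y <= exp y]. Only an upper bound on the sum is then required, so a one-sided tail
    suffices for the products. *)
Lemma prod1D_le_expR (R : realType) (m n : nat) (f : nat -> R) :
  (forall i, (m <= i < n)%N -> -1 <= f i) ->
  0 <= \prod_(m <= i < n) (1 + f i) <= expR (\sum_(m <= i < n) f i).
Proof.
move=> f1; rewrite expR_sum !big_nat; apply/andP; split.
  by apply: prodr_ge0 => i /f1; lra.
apply: ler_prod => i /f1 fi; rewrite expR_ge1Dx andbT; lra.
Qed.

(** * Data and reversed rounding errors as one sequence *)

Section combined_sequence.
Context d (T : measurableType d) (R : realType) (P : probability T R).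
Variables (n : nat) (x dl : nat -> {mfun T >-> R}).

(* The data come first, then the rounding errors backwards in time, so that
   the product [(1 + dl k.+1) * ... * (1 + dl n)] is known before [dl k]. *)
Definition data_then_errors (j : nat) : {mfun T >-> R} :=
  if (j < n)%N then x j.+1 else dl (n + n - j)%N.

(** Stated for any commutative operation and any [F], to serve both for intersections of events and
    for products of their probabilities. *)
Lemma big_data_then_errors (S : Type) (idx : S) (op : Monoid.com_law idx)
    (F : nat -> {mfun T >-> R} -> S) : (0 < n)%N ->
  \big[op/idx]_(i <- iota 0 (n + n.-1)) F i (data_then_errors i) =
  op (\big[op/idx]_(k <- iota 2 n.-1) F (n + n - k)%N (dl k))
     (\big[op/idx]_(i <- iota 1 n) F i.-1 (x i)).
Proof.
move=> n0; rewrite [RHS]Monoid.mulmC.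
have -> : iota 0 (n + n.-1) = index_iota 0 (n + n.-1).
  by rewrite /index_iota subn0.
have -> : iota 1 n = index_iota 1 n.+1 by rewrite /index_iota subn1.
have -> : iota 2 n.-1 = index_iota (n + n - (n + n.-1)).+1 n.+1.
  by rewrite /index_iota; congr iota; lia.
rewrite (@big_cat_nat _ _ _ n)//= ?leq_addr//; congr (op _ _).
  rewrite big_add1/=; apply: eq_big_nat => i /andP[_ ni].
  by rewrite /data_then_errors ni.
rewrite -big_nat_reflect; last by lia.
apply: eq_big_nat => i /andP[ni iN]; rewrite /data_then_errors ltnNge ni/=.
by congr (F _ _); lia.
Qed.

(** The independence of the two vectors splits the event into its error and data parts; each part
    then factors by its own mutual independence. *)
Lemma indep_data_then_errors : (0 < n)%N ->
  mutually_independent P (iota 1 n) (fun i => x i : T -> R) ->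
  mutually_independent P (iota 2 n.-1) (fun k => dl k : T -> R) ->
  vectors_independent P (iota 2 n.-1) (fun k => dl k : T -> R)
                        (iota 1 n) (fun i => x i : T -> R) ->
  mutually_independent P (iota 0 (n + n.-1)) (fun i => data_then_errors i : T -> R).
Proof.
move=> n0 hx hd hxd A mA.
rewrite bigcap_seq (big_data_then_errors _ (fun i f => f @^-1` A i))//.
rewrite (big_data_then_errors _ (fun i f => P (f @^-1` A i)))//.
rewrite -!bigcap_seq.
have := hxd (fun k => A (n + n - k)%N) (fun i => A i.-1).
move=> -> //; rewrite (hx (fun i => A i.-1))//.
by rewrite (hd (fun k => A (n + n - k)%N)).
Qed.

End combined_sequence.

Lemma integral_centered d (T : measurableType d) (R : realType)
    (P : probability T R) (Y : {RV P >-> R}) (y c : R) :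
  ('E_P[Y] = y%:E)%E -> {ae P, forall t, `|Y t - y| <= c} ->
  (\int[P]_t (Y t - y)%:E = 0)%E.
Proof.
rewrite expectation_def => EY Yc.
have iY : P.-integrable setT (EFin \o Y).
  apply: (@ae_bounded_integrable _ _ _ _ _ (`|y| + c)) => //.
  apply: filterS Yc => t le; rewrite -[Y t](subrK y) addrC.
  by rewrite (le_trans (ler_normD _ _))// lerD2l.
under eq_integral do rewrite EFinB.
rewrite integralB//=; last exact: finite_measure_integrable_cst.
by rewrite EY integral_cst//= probability_setT mule1 subee.
Qed.

(** The reason for the choice of [lam]: the two-sided tail [2 exp (- lam^2 / 2)] equals [dlt]. *)
Lemma expR_lam (R : realType) (dlt : R) : 0 < dlt -> dlt < 1 ->
  0 < lam dlt /\ expR (- (lam dlt ^+ 2 / 2)) = dlt / 2.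
Proof.
move=> d0 d1.
have l0 : 0 < ln (2 / dlt) by rewrite ln_gt0// ltr_pdivlMr//; lra.
split; first by rewrite sqrtr_gt0 mulr_gt0.
rewrite sqr_sqrtr; last by rewrite mulr_ge0// ltW.
rewrite mulrAC divff// mul1r expRN lnK ?posrE ?divr_gt0//.
by rewrite invf_div.
Qed.

Lemma probability_ge_of_bad d (T : measurableType d) (R : realType)
    (P : probability T R) (A B : set T) (q : R) :
  measurable A -> measurable B -> (P B <= q%:E)%E -> ~` B `<=` A ->
  ((1 - q)%:E <= P A)%E.
Proof.
move=> mA mB PB BA.
apply: (@le_trans _ _ (P (~` B))); last first.
  by apply: le_measure => //; rewrite inE//; exact: measurableC.
by rewrite probability_setC// EFinB leeB.
Qed.

(** At position [j = 2 n - k], the later errors [dl_l], [l > k], occupy the positions from [n] to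
    [j - 1], and [s_k] sums the first [2 n - j] entries. *)
Lemma rec_sum_error_reversed (R : realType) (T : Type) (n : nat)
    (x dl w : nat -> T -> R) t : (0 < n)%N ->
  (forall i, (i < n)%N -> w i = x i.+1) ->
  (forall i, (n <= i < n + n.-1)%N -> w i = dl (n + n - i)%N) ->
  rec_sum x dl n t - exact_sum x n t =
  \sum_(n <= j < n + n.-1) (\sum_(0 <= i < n + n - j) w i t)
    * \prod_(n <= i < j) (1 + w i t) * w j t.
Proof.
move=> n0 wx wdl.
have [p np] : exists p, n = p.+1 by exists n.-1; rewrite prednK.
(* The lower index is 2, written in the form that [big_nat_reflect] expects. *)
have -> : rec_sum x dl n t - exact_sum x n t =
    \sum_((n + n - (n + n.-1)).+1 <= k < n.+1) exact_sum x k t * dl k t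
    * \prod_(k.+1 <= j < n.+1) (1 + dl j t).
  rewrite np rec_sum_error; congr bigop; congr index_iota; lia.
rewrite -big_nat_reflect; last by lia.
apply: eq_big_nat => j /andP[nj jN].
rewrite wdl ?nj// mulrAC; congr (_ * _ * _).
  rewrite /exact_sum big_add1/=; apply: eq_big_nat => i /andP[_ ij].
  by rewrite wx//; lia.
rewrite -big_nat_reflect; last by lia.
by apply: eq_big_nat => i /andP[ni ij]; rewrite wdl//; lia.
Qed.

(** * The union bound and the final estimate *)

Theorem theorem5p2 (R : realType) (d : measure_display) (T : measurableType d)
  (P : probability T R) (n : nat)
  (x dl : nat -> {RV P >-> R}) (mu Cx u : R)
  (hx_indep : mutually_independent P (iota 1 n) (fun i => x i : T -> R))
  (hx_mean : forall i, (1 <= i <= n)%N -> ('E_P[x i] = mu%:E)%E)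
  (hx_bd : forall i, (1 <= i <= n)%N ->
     {ae P, forall t, `|x i t - mu| <= Cx})
  (hd_indep : mutually_independent P (iota 2 n.-1) (fun k => dl k : T -> R))
  (hd_mean : forall k, (2 <= k <= n)%N -> ('E_P[dl k] = 0)%E)
  (hd_bd : forall k, (2 <= k <= n)%N -> {ae P, forall t, `|dl k t| <= u})
  (hu0 : 0 < u) (hu1 : u < 1)
  (hxd_indep : vectors_independent P (iota 2 n.-1) (fun k => dl k : T -> R)
                                     (iota 1 n) (fun i => x i : T -> R))
  (dlt : R) (hdlt0 : 0 < dlt) (hdlt1 : dlt < 1) :
  let xs := fun i => (x i : T -> R) in
  let ds := fun k => (dl k : T -> R) in
  let lambda := lam (dlt / 3) in
  (P [set t | ( `|rec_sum xs ds n t - exact_sum xs n t| <=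
      (1 + gamma_tilde n u (dlt / 3)) *
      (lambda * `|mu| * (n%:R * Num.sqrt n%:R) + lambda ^+ 2 * Cx * n%:R) * u)%R]
   >= (1 - dlt)%:E)%E.
Proof.
cbv zeta; set lambda := lam (dlt / 3).
pose xs (i : nat) : T -> R := x i; pose ds (i : nat) : T -> R := dl i.
rewrite -/xs -/ds.
have [n0|n0] := posnP n.
  rewrite (_ : [set t | _] = setT) ?probability_setT ?lee_fin ?gerBl ?ltW//.
  apply/seteqP; split => // t _ /=; rewrite n0 /exact_sum big_geq//= subrr normr0.
  by rewrite !(mul0r, mulr0) addr0 !(mul0r, mulr0).
have [l0 expl] : 0 < lambda /\ expR (- (lambda ^+ 2 / 2)) = dlt / 3 / 2.
  by apply: expR_lam; lra.
pose W := data_then_errors n x dl.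
pose N := (n + n.-1)%N.
have WxE i : (i < n)%N -> W i = x i.+1 by rewrite /W /data_then_errors => ->.
have WdE i : (n <= i)%N -> W i = dl (n + n - i)%N.
  by rewrite /W /data_then_errors ltnNge => ->.
have nN : (n <= N)%N by exact: leq_addr.
have indepN : mutually_independent P (iota 0 N) (fun i => W i : T -> R).
  exact: indep_data_then_errors.
have indepn := mutually_independent_iota_le nN indepN.
have Wx_bd k : (0 <= k < n)%N -> {ae P, forall t, `|W k t - mu| <= Cx}.
  by move=> /andP[_ kn]; rewrite WxE//; exact: hx_bd.
have Wx_mean k : (0 <= k < n)%N -> (\int[P]_t (W k t - mu)%:E = 0)%E.
  move=> kn; apply: (@integral_centered _ _ _ P (W k) mu Cx); last exact: Wx_bd.
  by move: kn => /andP[_ kn]; rewrite WxE//; exact: hx_mean.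
have Wd_bd k : (n <= k < N)%N -> {ae P, forall t, `|W k t - 0| <= u}.
  move=> /andP[nk kN].
  have kn : (2 <= n + n - k <= n)%N by rewrite /N in kN; lia.
  by rewrite WdE//; apply: filterS (hd_bd _ kn) => t; rewrite subr0.
have Wd_mean k : (n <= k < N)%N -> (\int[P]_t (W k t - 0)%:E = 0)%E.
  move=> nk; apply: (@integral_centered _ _ _ P (W k) 0 u); last exact: Wd_bd.
  move: nk => /andP[nk kN]; rewrite WdE//; apply: hd_mean.
  by rewrite /N in kN; lia.
have Cx0 : 0 <= Cx.
  have [t] := ae_exists (Wx_bd 0%N n0); exact: le_trans.
pose q := Num.sqrt n%:R : R.
have q0 : 0 <= q by exact: sqrtr_ge0.
have qN : Num.sqrt (N - n)%:R <= q.
  by rewrite ler_wsqrtr// ler_nat /N; lia.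
pose S := n%:R * `|mu| + lambda * q * Cx.
have S0 : 0 <= S by rewrite addr_ge0 ?mulr_ge0// ltW.
pose M := expR (lambda * q * u).
have M0 : 0 <= M by exact: expR_ge0.
(* After multiplication by [1 - u] the exponents differ by [lambda q u^2 + n u^2 >= 0]. *)
have MG : M <= 1 + gamma_tilde n u (dlt / 3).
  rewrite /gamma_tilde addrC subrK ler_expR -/lambda -/q.
  rewrite ler_pdivlMr ?subr_gt0//.
  have : 0 <= lambda * q * u * u by rewrite !mulr_ge0// ltW.
  have : 0 <= n%:R * u ^+ 2 by rewrite mulr_ge0// sqr_ge0.
  lra.
(* For [j >= n] the partial sum uses indices below [2 n - j <= j], so [a j] is predictable. The
   value 0 for [j < n] is a default outside the range of the martingale. *)
pose a (j : nat) (t : T) : R := if (n <= j)%N then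
  (\sum_(0 <= i < n + n - j) W i t) * \prod_(n <= i < j) (1 + W i t) else 0.
(* The truncation depends on [a j] alone, so it stays predictable, and it makes the bound hold at
   every point. *)
pose a' (j : nat) (t : T) : R := if `|a j t| <= S * M then a j t else 0.
have ma j : adapted W j (a j).
  rewrite /a; have [nj|_] := leqP n j; last exact: measurable_cst.
  apply: measurable_funM.
    apply: adapted_sum => i /andP[_ ij]; apply: adapted_nth.
    by rewrite (leq_trans ij)// leq_subLR leq_add.
  apply: adapted_prod => i /andP[_ ij].
  by apply: measurable_funD => //; exact: adapted_nth.
have ma' j : adapted W j (a' j).
  apply: measurable_fun_ifT => //; last exact: ma.
  apply: measurable_fun_ler => //; apply: measurableT_comp => //; exact: ma.
have a'b j t : `|a' j t| <= S * M.
  by rewrite /a'; case: ifP => //; rewrite normr0 mulr_ge0.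
have m1 k : adapted W k (fun=> 1) by exact: measurable_cst.
have b1 (k : nat) (t : T) : `|1 : R| <= 1 by rewrite normr1.
have [B1 [mB1 PB1 good1]] := azuma_max_abs indepn Wx_mean Wx_bd l0 (leq0n n) m1 b1.
have [B2 [mB2 PB2 good2]] := azuma_max indepN Wd_mean Wd_bd l0 nN m1 b1.
have [B3 [mB3 PB3 good3]] := azuma_max_abs indepN Wd_mean Wd_bd l0 nN ma' a'b.
(* A null set off which all rounding errors satisfy their bound at once; it makes the factors
   [1 + W i t] nonnegative. *)
have [B4 [mB4 PB4 good4]] :
    {ae P, forall t, forall k, (n <= k < N)%N -> `|W k t - 0| <= u}.
  apply: ae_foralln => k; have [kN|kN] := boolP (n <= k < N)%N.
    by apply: filterS (Wd_bd k kN).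
  exact: aeW.
apply: (@probability_ge_of_bad _ _ _ _ _ (B1 `|` B2 `|` (B3 `|` B4))).
- apply: (measurable_set_le (g := cst _)) => //.
  apply: measurableT_comp => //; apply: measurable_funB.
    exact: measurable_rec_sum.
  exact: measurable_sum.
- by do !apply: measurableU.
(* The total is [dlt / 3 + dlt / 6 + dlt / 3 + 0], that is [5 dlt / 6]. *)
- apply: (@le_trans _ _ ((2 * (dlt / 3 / 2))%:E + (dlt / 3 / 2)%:E
    + ((2 * (dlt / 3 / 2))%:E + 0))%E).
    rewrite expl in PB1 PB2 PB3.
    have mB12 := measurableU _ _ mB1 mB2; have mB34 := measurableU _ _ mB3 mB4.
    apply: (le_trans (measureU2 P mB12 mB34)).
    apply: leeD.
      by apply: (le_trans (measureU2 P mB1 mB2)); exact: leeD.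
    apply: (le_trans (measureU2 P mB3 mB4)); apply: leeD => //.
    by move/eqP: PB4; rewrite eq_le => /andP[].
  by rewrite adde0 -!EFinD lee_fin; move: hdlt0; clear; lra.
move=> t /not_orP[/not_orP[nB1 nB2] /not_orP[nB3 nB4]] /=.
have Wu k : (n <= k < N)%N -> `|W k t| <= u.
  move=> kN; rewrite -[W k t]subr0.
  by apply: contrapT => nWu; apply: nB4; apply: good4 => /(_ k kN).
(* Off the exceptional sets the truncation is inactive: [B1] controls the partial sum by [S], [B2]
   and [B4] the product by [M]. *)
have aS j : (n <= j < N)%N -> `|a j t| <= S * M.
  move=> /andP[nj jN]; rewrite /a nj normrM ler_pM//.
    have jn : (0 <= n + n - j <= n)%N by rewrite leq_subLR leq_add2r.
    have := good1 t nB1 _ jn; rewrite /mart subn0 mul1r -/q.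
    rewrite (eq_bigr (fun i => W i t - mu)); last by move=> i _; rewrite mul1r.
    rewrite sumrB sumr_const_nat subn0 => dev.
    rewrite -[X in `|X|](subrK (mu *+ (n + n - j))) addrC.
    apply: (le_trans (ler_normD _ _)); rewrite lerD//.
    by rewrite normrMn -[leLHS]mulr_natl ler_wpM2r// ler_nat leq_subLR leq_add2r.
  have /andP[pr0 pr1] : 0 <= \prod_(n <= i < j) (1 + W i t)
      <= expR (\sum_(n <= i < j) W i t).
    apply: prod1D_le_expR => i /andP[ni ij].
    have := Wu i; rewrite ni (ltn_trans ij jN) => /(_ isT).
    by rewrite ler_norml => /andP[Wl _]; rewrite (le_trans _ Wl)// lerN2 ltW.
  rewrite ger0_norm//; apply: (le_trans pr1); rewrite ler_expR.
  have njN : (n <= j <= N)%N by rewrite nj ltnW.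
  have := good2 t nB2 _ njN; rewrite /mart mul1r.
  rewrite (eq_bigr (fun i => W i t)); last by move=> i _; rewrite mul1r subr0.
  move=> /le_trans; apply; apply: ler_wpM2r; first exact: ltW.
  by apply: ler_wpM2l => //; exact: ltW.
have -> : rec_sum xs ds n t - exact_sum xs n t = mart W n (fun=> 0) a' N t.
  rewrite (@rec_sum_error_reversed _ _ _ _ _ (fun i => W i : T -> R))//.
  - rewrite /mart; apply: eq_big_nat => j nj; rewrite subr0 /a' aS//.
    by case/andP: nj => nj _; rewrite /a nj.
  - by move=> i /WxE ->.
  - by move=> i /andP[/WdE -> _].
have nNN : (n <= N <= N)%N by rewrite nN leqnn.
apply: (le_trans (good3 t nB3 _ nNN)).
(* Both terms share the factor [lambda q], since [n = q^2]. *)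
have -> : lambda * `|mu| * (n%:R * q) + lambda ^+ 2 * Cx * n%:R = lambda * q * S.
  have nq : n%:R = q * q :> R by rewrite -expr2 sqr_sqrtr.
  by rewrite /S mulrDr; congr (_ + _); [ring|rewrite nq; ring].
have -> : (1 + gamma_tilde n u (dlt / 3)) * (lambda * q * S) * u =
  lambda * q * (S * (1 + gamma_tilde n u (dlt / 3)) * u) by ring.
apply: ler_pM => //.
- by rewrite mulr_ge0 ?sqrtr_ge0// ltW.
- by rewrite !mulr_ge0// ltW.
- by rewrite ler_wpM2l// ltW.
- by apply: ler_wpM2r; [exact: ltW|exact: ler_wpM2l].
Qed.
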